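(* $\mathrm{cof}(\mathcal{M})=\max\{\mathfrak{d},\mathrm{supcov}\}$.
   Context: $\mathcal{M}$ is the meager ideal; $\mathfrak{d}$ the dominating number. Yorioka ideals: for $\sigma\in(2^{<\omega})^\omega$, $[\sigma]_\infty=\{x\in2^\omega:\exists^\infty n\,(\sigma(n)\subseteq x)\}$, $h_\sigma(i)=|\sigma(i)|$; $f\ll g$ iff $\forall k\,\forall^\infty n\,(f(n^k)\leq g(n))$; $\mathcal{J}_g=\{X\subseteq2^\omega:\exists\sigma\,(X\subseteq[\sigma]_\infty,\ h_\sigma=g)\}$; $\mathcal{I}_f=\bigcup_{g\gg f}\mathcal{J}_g$. $\mathrm{supcov}=\sup\{\mathrm{cov}(\mathcal{I}_f):f\in\omega^\omega\text{ increasing}\}$. *)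

(* Defs.v *)
From HB Require Import structures.
From mathcomp Require Import all_boot all_order.
From mathcomp Require Import boolp classical_sets functions cardinality.
From mathcomp Require Import topology cantor.

Set Implicit Arguments.
Unset Strict Implicit.
Unset Printing Implicit Defensive.

Import Order.TTheory.

Local Open Scope classical_set_scope.
Local Open Scope card_scope.

(* A cardinal is an equipotence class of subsets of [set cantor_space], so only
   the cardinals up to 2^(2^aleph_0) are represented.  They form an initial
   segment of all cardinals and contain the cardinality of every family of
   subsets of 2^omega and of every family of functions from omega to omega;
   minima and suprema of sets of such cardinals are thus the usual ones.
   (A type of equipotence classes of arbitrary types would be too large for the
   monomorphic universe of [set].)  Leibniz equality of cardinals is
   equipotence, see [cardinal_of_eq]. *)
Definition equipotence_class (A : set (set cantor_space)) :
    set (set (set cantor_space)) :=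
  [set B | B #= A].

Record cardinal := Cardinal {
  cardinal_class : set (set (set cantor_space)) ;
  _ : exists A, cardinal_class = equipotence_class A }.

Definition cardinal_of (A : set (set cantor_space)) : cardinal :=
  Cardinal (ex_intro _ A (erefl (equipotence_class A))).

Definition has_cardinality (T : Type) (A : set T) (c : cardinal) :=
  exists2 B, cardinal_class c B & B #= A.

Lemma cardinal_of_eq (A B : set (set cantor_space)) :
  cardinal_of A = cardinal_of B <-> A #= B.
Proof.
split=> [[e]|AB].
  have : equipotence_class B A by rewrite -e; exact: card_eqxx.
  by [].
have e : equipotence_class A = equipotence_class B.
  apply/seteqP; split=> C /= h; first exact: card_eq_trans h AB.
  by apply: card_eq_trans h _; rewrite card_eq_sym.
rewrite /cardinal_of; move: (ex_intro _ A _) (ex_intro _ B _).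
by rewrite e => p q; rewrite (Prop_irrelevance p q).
Qed.

Lemma cardinal_ofP (c : cardinal) : exists A, c = cardinal_of A.
Proof.
case: c => C p; case: (p) => A e; exists A; subst C.
by congr Cardinal; exact: Prop_irrelevance.
Qed.

Lemma has_cardinality_of (T : Type) (A : set T) B :
  has_cardinality A (cardinal_of B) <-> B #= A.
Proof.
split=> [[C CB CA]|BA]; last by exists B; first exact: card_eqxx.
by apply: card_eq_trans CA; rewrite card_eq_sym.
Qed.

Lemma has_cardinality_ex (T : Type) (A : set T) :
  A #<= [set: set cantor_space] -> exists c, has_cardinality A c.
Proof.
by move=> /card_subP[B BA _]; exists (cardinal_of B); apply/has_cardinality_of.
Qed.

HB.instance Definition _ := gen_eqMixin cardinal.
HB.instance Definition _ := gen_choiceMixin cardinal.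

Definition cardinal_le (a b : cardinal) : bool :=
  `[< exists A B, [/\ cardinal_class a A, cardinal_class b B & A #<= B] >].

Lemma cardinal_le_of (A B : set (set cantor_space)) :
  cardinal_le (cardinal_of A) (cardinal_of B) = (A #<= B).
Proof.
apply/asboolP/idP => [[A' [B' [AA BB le]]]|le].
  by rewrite -(card_le_eql AA) -(card_le_eqr BB).
by exists A, B; split=> //; exact: card_eqxx.
Qed.

Lemma cardinal_le_refl : reflexive cardinal_le.
Proof.
by move=> c; have [A ->] := cardinal_ofP c; rewrite cardinal_le_of card_lexx.
Qed.

Lemma cardinal_le_anti : antisymmetric cardinal_le.
Proof.
move=> a b; have [A ->] := cardinal_ofP a; have [B ->] := cardinal_ofP b.
rewrite !cardinal_le_of => /andP[AB BA]; apply/cardinal_of_eq.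
exact: Cantor_Bernstein.
Qed.

Lemma cardinal_le_trans : transitive cardinal_le.
Proof.
move=> b a c; have [A ->] := cardinal_ofP a; have [B ->] := cardinal_ofP b.
by have [C ->] := cardinal_ofP c; rewrite !cardinal_le_of; exact: card_le_trans.
Qed.

Lemma injective_card_le (T U : Type) (f : T -> U) :
  injective f -> [set: T] #<= [set: U].
Proof.
move=> finj; apply: (@card_le_trans _ _ _ (range f)); last exact: card_leT.
by have := inj_card_eq (in2W finj : {in [set: T] &, injective f});
  rewrite card_eq_le => /andP[].
Qed.

(* Well-foundedness of the comparison of cardinals: a maximal subset of the
   product of the [T i] on which all projections are injective projects onto
   some [T i]. *)
Lemma least_type (I : Type) (T : I -> Type) : inhabited I ->
  exists i, forall j, exists f : T i -> T j, injective f.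
Proof.
move=> [i0].
pose inj_proj (P : set (forall i, T i)) :=
  forall i p q, P p -> P q -> p i = q i -> p = q.
pose X := {P | inj_proj P}.
pose R (P Q : X) : bool := `[< sval P `<=` sval Q >].
have [|||C Ctot|[P Pinj] Pmax] := @Zorn X R.
- by move=> P; apply/asboolP.
- move=> P Q S /asboolP PQ /asboolP QS; apply/asboolP.
  exact: subset_trans PQ QS.
- move=> [P p] [Q q] /asboolP /= PQ /asboolP /= QP.
  have PQe : P = Q by rewrite eqEsubset; split.
  by subst Q; congr exist; exact: Prop_irrelevance.
- have Uinj : inj_proj (\bigcup_(P in C) sval P).
    move=> i p q [P CP Pp] [Q CQ Qq].
    have [/asboolP PQ|/asboolP QP] := Ctot _ _ CP CQ.
      by apply: (svalP Q) => //; exact: PQ.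
    by apply: (svalP P) => //; exact: QP.
  exists (exist _ _ Uinj) => P CP; apply/asboolP => /= p Pp; by exists P.
have [[i iP]|] := pselect (exists i, forall y, exists2 p, P p & p i = y).
  have {}iP y : exists p, P p /\ p i = y by have [p Pp e] := iP y; exists p.
  exists i => j; have [g gP] := choice iP.
  exists (fun y => g y j) => y z /= e.
  have [[Py <-] [Pz <-]] := (gP y, gP z); by rewrite (Pinj _ _ _ Py Pz e).
move=> /forallNP noi.
have {}noi i : exists y : T i, forall p, P p -> p i <> y.
  have /existsNP[y yP] := noi i; exists y => p Pp e; apply: yP; by exists p.
pose g i : T i := sval (cid (noi i)).
have gP i p : P p -> p i <> g i by rewrite /g; case: cid => y /= /[apply].
have Qinj : inj_proj (P `|` [set g]).
  move=> i p q [Pp|->] [Pq|->] //; first exact: (Pinj i).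
    by move=> /(gP i p Pp).
  by move=> /esym /(gP i q Pq).
have : R (exist _ P Pinj) (exist _ _ Qinj).
  by apply/asboolP => /= p Pp; left.
move=> /Pmax [] QP; have : (P `|` [set g]) g by right.
by rewrite QP => /(gP i0); case.
Qed.

Lemma least_set (I : Type) (A : I -> set (set cantor_space)) : inhabited I ->
  exists i, forall j, A i #<= A j.
Proof.
move=> /(least_type A)[i iP]; exists i => j; have [f] := iP j.
move=> /injective_card_le.
by rewrite (card_le_eql (card_setT _)) (card_le_eqr (card_setT _)).
Qed.

Lemma cardinal_le_total : total cardinal_le.
Proof.
move=> a b; have [A ->] := cardinal_ofP a; have [B ->] := cardinal_ofP b.
rewrite !cardinal_le_of.
have [] := @least_set bool (fun x => if x then A else B) (inhabits true).
by move=> [] /=; [move=> /(_ false)|move=> /(_ true)] => ->; rewrite ?orbT.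
Qed.

Fact cardinal_display : Order.disp_t. Proof. exact: Order.Disp tt tt. Qed.

HB.instance Definition _ := Order.Le_isPOrder.Build cardinal_display cardinal
  cardinal_le_refl cardinal_le_anti cardinal_le_trans.
HB.instance Definition _ := Order.POrder_isTotal.Build cardinal_display cardinal
  cardinal_le_total.

Definition cardinal0 : cardinal := cardinal_of set0.

(* The least element of [S]; the default [cardinal0] is only taken for
   [S = set0], see [cardinal_minP]. *)
Definition cardinal_min (S : set cardinal) : cardinal :=
  xget cardinal0 (S `&` lbound S).

Definition cardinal_sup (S : set cardinal) : cardinal := supremum cardinal0 S.

Lemma cardinal_minP (S : set cardinal) : S !=set0 ->
  S (cardinal_min S) /\ lbound S (cardinal_min S).
Proof.
move=> [c Sc]; suff : exists m, (S `&` lbound S) m.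
  by move=> [m Sm]; exact: (xgetI cardinal0 Sm).
pose A (x : {c | S c}) := sval (cid (cardinal_ofP (sval x))).
have AE x : sval x = cardinal_of (A x) by rewrite /A; case: cid.
have [x xP] := least_set A (inhabits (exist _ c Sc)).
exists (sval x); split=> [|d Sd]; first exact: (svalP x).
have -> : d = cardinal_of (A (exist _ d Sd)) by rewrite -AE.
by rewrite AE; have := xP (exist _ d Sd); rewrite -cardinal_le_of.
Qed.

Lemma cardinal_supP (S : set cardinal) : supremums S (cardinal_sup S).
Proof.
have cardinal_ge0 c : (cardinal0 <= c)%O.
  have [A ->] := cardinal_ofP c.
  by have := @card_ge0 (set cantor_space) _ A; rewrite -cardinal_le_of.
rewrite /cardinal_sup /supremum; case: ifPn => [/eqP ->|S0].
  by split=> [? []|? _].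
have [|ub lb] := @cardinal_minP (ubound S).
  exists (cardinal_of setT) => c _; have [A ->] := cardinal_ofP c.
  by have := card_leT A; rewrite -cardinal_le_of.
exact: (xgetI cardinal0 (conj ub lb)).
Qed.

Definition is_covering (I F : set (set cantor_space)) :=
  F `<=` I /\ \bigcup_(A in F) A = [set: cantor_space].

Definition is_cofinal (I F : set (set cantor_space)) :=
  F `<=` I /\ forall A, I A -> exists2 B, F B & A `<=` B.

Definition cov (I : set (set cantor_space)) : cardinal :=
  cardinal_min [set c | exists2 F, is_covering I F & has_cardinality F c].

Definition cof (I : set (set cantor_space)) : cardinal :=
  cardinal_min [set c | exists2 F, is_cofinal I F & has_cardinality F c].

Definition eventually_le (f g : nat -> nat) :=
  \forall n \near \oo, (f n <= g n)%N.

Definition is_dominating (D : set (nat -> nat)) :=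
  forall f, exists2 g, D g & eventually_le f g.

Definition dominating_number : cardinal :=
  cardinal_min [set c | exists2 D, is_dominating D & has_cardinality D c].

Definition nowhere_dense (T : topologicalType) (A : set T) :=
  interior (closure A) = set0.

Definition meager (T : topologicalType) : set (set T) :=
  [set A | exists2 F : nat -> set T,
    forall n, nowhere_dense (F n) & A = \bigcup_n F n].
Arguments meager T : clear implicits.

Definition initial_segment (s : seq bool) (x : cantor_space) :=
  forall i, (i < size s)%N -> nth false s i = x i.

(* The set written [sigma]_oo in the literature. *)
Definition infinitely_often (sigma : nat -> seq bool) : set cantor_space :=
  [set x | forall m, exists2 n, (m <= n)%N & initial_segment (sigma n) x].

Definition height (sigma : nat -> seq bool) : nat -> nat :=
  fun i => size (sigma i).

Definition much_less (f g : nat -> nat) :=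
  forall k, \forall n \near \oo, (f (n ^ k) <= g n)%N.

Definition yorioka_J (g : nat -> nat) : set (set cantor_space) :=
  [set X | exists2 sigma, X `<=` infinitely_often sigma & height sigma = g].

Definition yorioka (f : nat -> nat) : set (set cantor_space) :=
  \bigcup_(g in [set g | much_less f g]) yorioka_J g.

Definition increasing (f : nat -> nat) := {homo f : m n / (m < n)%N}.

Definition supcov : cardinal :=
  cardinal_sup [set cov (yorioka f) | f in increasing].

Lemma yorioka_covering f : increasing f ->
  is_covering (yorioka f) (yorioka f).
Proof.
move=> fincr; split=> //; rewrite -subTset => x _.
exists [set x] => //; exists (fun n => f (n ^ n)%N).
  move=> k; near=> n.
  have fmono : {mono f : m n / (m <= n)%N} := leq_mono fincr.
  rewrite fmono; have [k0 kn] : (0 < n)%N /\ (k <= n)%N.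
    by split; near: n; [exact: nbhs_infty_gt|exact: nbhs_infty_ge].
  exact: leq_pexp2l.
exists (fun n => mkseq x (f (n ^ n)%N)); last first.
  by apply/funext => n; rewrite /height size_mkseq.
move=> _ -> m; exists m => // i; rewrite size_mkseq => im.
by rewrite nth_mkseq.
Unshelve. all: by end_near. Qed.

Lemma covP f : increasing f ->
  exists2 F, is_covering (yorioka f) F & has_cardinality F (cov (yorioka f)).
Proof.
move=> fincr; have [|//] := @cardinal_minP
  [set c | exists2 F, is_covering (yorioka f) F & has_cardinality F c].
have [c fc] := has_cardinality_ex (card_leT (yorioka f)).
by exists c, (yorioka f); first exact: yorioka_covering.
Qed.

Lemma cofP I : exists2 F, is_cofinal I F & has_cardinality F (cof I).
Proof.
have [|//] := @cardinal_minP
  [set c | exists2 F, is_cofinal I F & has_cardinality F c].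
have [c Ic] := has_cardinality_ex (card_leT I).
by exists c, I => //; split=> // A IA; exists A.
Qed.

Lemma dominating_numberP :
  exists2 D, is_dominating D & has_cardinality D dominating_number.
Proof.
have [|//] := @cardinal_minP
  [set c | exists2 D, is_dominating D & has_cardinality D c].
pose graph (f : nat -> nat) : cantor_space := fun m =>
  if @unpickle (nat * nat)%type m is Some (a, b) then f a == b else false.
have graph_inj : injective (fun f => [set graph f]).
  move=> f g fg; apply/funext => a; apply/esym/eqP.
  have : [set graph g] (graph f) by rewrite -fg.
  move=> /(congr1 (fun h : nat -> bool => h (pickle (a, f a)))).
  by rewrite /graph pickleK eqxx => <-.
have [c cT] := has_cardinality_ex (injective_card_le graph_inj).
exists c, setT => // f; exists f => //; exact: nearW.
Qed.

(* Main.v *)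
(** For an increasing [h] let [I_n = [h n, h (n + 1))].  Every meager set is
    contained in some meager set
      [differs x h = {z | z and x differ on I_n for almost all n}],
    which does not contain [x].

    Lower bound.  Let [F] be cofinal in the meager ideal.  If [f] is monotone,
    the sets meeting almost all [[n, f n]] form a meager set, and
    [differs y h] can only contain it when [k |-> h (2k + 1)] eventually
    dominates [f]; so [F] yields a dominating family.  Choosing a point outside
    each member of [F] gives a nonmeager set, and the translates by its points
    of one comeager set [[sigma]_oo] in the Yorioka ideal of [f] cover the space
    (Rothberger's argument).

    Upper bound.  A meager set lies in some [differs x j] with [j] taken from a
    dominating family.  A covering by sets in the Yorioka ideal of
    [n |-> j (n + 1)] provides, for each of its members [[sigma]_oo], the point
    [y] that agrees with [sigma n] on the [n]-th block of [j]; the member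
    containing [x] gives a [y] agreeing with [x] on infinitely many blocks.  A
    second element of the dominating family merges the blocks so that almost
    every merged block contains one of agreement, whence [differs x j] is
    contained in [differs y j'].  The resulting family is indexed by a cube, and
    infinite cardinals equal their squares. *)

Require Import Defs.
From mathcomp Require Import all_boot all_order.
From mathcomp Require Import boolp classical_sets functions cardinality topology cantor.

Set Implicit Arguments.
Unset Strict Implicit.
Unset Printing Implicit Defensive.

Import Order.TTheory.

Local Open Scope classical_set_scope.
Local Open Scope card_scope.

(** * Squares of infinite cardinals *)

Lemma injection_total (T : Type) (A B : set T) :
  (exists2 g : T -> T, forall x, A x -> B (g x) & {in A &, injective g}) \/
  (exists2 g : T -> T, forall x, B x -> A (g x) & {in B &, injective g}).
Proof.
have extend (C D : set T) (g : {x | C x} -> {x | D x}) : injective g ->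
    exists2 g : T -> T, forall x, C x -> D (g x) & {in C &, injective g}.
  move=> ginj.
  exists (fun x => if pselect (C x) is left Cx then sval (g (exist _ x Cx))
                   else x).
    by move=> x Cx; case: pselect => // Cx'; exact: svalP.
  move=> x y /set_mem Cx /set_mem Cy.
  case: pselect => // Cx'; case: pselect => // Cy' e.
  have /ginj [//] : g (exist _ x Cx') = g (exist _ y Cy').
  by apply: eq_sig_hprop => // z p q; exact: Prop_irrelevance.
have [[] h] := least_type (fun b => {x | (if b then A else B) x})
  (inhabits true).
- by left; have [g] := h false; exact: extend.
- by right; have [g] := h true; exact: extend.
Qed.

Section Squares.
Variable T : Type.
Implicit Types R S : set (T * T * T).

(** A pairing is defined on the whole square of its field, so the field can be read off the
    diagonal. *)
Definition field_of R := [set x | exists z, R (x, x, z)].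

(* [R] contains the graph of an injection from the square of its field to its
   field. *)
Definition is_pairing R :=
  [/\ forall x y z, R (x, y, z) ->
        [/\ field_of R x, field_of R y & field_of R z],
      forall x y, field_of R x -> field_of R y -> exists z, R (x, y, z) &
      forall x y x' y' z, R (x, y, z) -> R (x', y', z) -> x = x' /\ y = y'].

(** Each clause of [is_pairing] concerns at most two triples, and these already lie in [R] joined
    with a single member of the chain. Keeping [R] apart covers the empty chain. *)
Lemma bigcup_pairing R (F : set (set (T * T * T))) : is_pairing R ->
  (forall S, F S -> is_pairing (R `|` S)) -> total_on F subset ->
  is_pairing (R `|` \bigcup_(S in F) S).
Proof.
move=> pR pF Ftot; set U := _ `|` _.
have common t t' : U t -> U t' ->
    exists S, [/\ is_pairing S, S t, S t' & S `<=` U].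
  have sub S : F S -> R `|` S `<=` U.
    by move=> FS u [|Su]; [left|right; exists S].
  move=> [Rt|[S FS St]] [Rt'|[S' FS' St']].
  - by exists R; split=> // u Ru; left.
  - by exists (R `|` S'); split; [exact: pF|left|right|exact: sub].
  - by exists (R `|` S); split; [exact: pF|right|left|exact: sub].
  - have [SS'|S'S] := Ftot _ _ FS FS'.
      exists (R `|` S'); split; [exact: pF|right; exact: SS'|by right|].
      exact: sub.
    exists (R `|` S); split; [exact: pF|by right|right; exact: S'S|].
    exact: sub.
split=> [x y z Uxyz|x y [z Ux] [z' Uy]|x y x' y' z Ut Ut'].
- have [S [[cl _ _] St _ SU]] := common _ _ Uxyz Uxyz.
  have [[a ?] [b ?] [c ?]] := cl _ _ _ St.
  by split; [exists a|exists b|exists c]; exact: SU.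
- have [S [[_ tot _] Sx Sy SU]] := common _ _ Ux Uy.
  have [w Sw] := tot x y (ex_intro _ z Sx) (ex_intro _ z' Sy).
  by exists w; exact: SU.
- have [S [[_ _ inj] St St' _]] := common _ _ Ut Ut'.
  exact: inj St St'.
Qed.

(** Zorn's lemma gives a maximal pairing above the one that [pickle] induces on the range of [i];
    let [B] be its field. If the complement of [B] injects into [B], then [T] injects into [B] and
    the pairing transports to [T]. Otherwise [B] has a disjoint copy, over which the pairing can be
    extended, against maximality. *)
Lemma square_injection (i : nat -> T) : injective i ->
  exists f : T * T -> T, injective f.
Proof.
move=> iinj.
pose R0 : set (T * T * T) :=
  [set t | exists m n, t = (i m, i n, i (pickle (m, n)))].
have field0 x : field_of R0 x <-> exists m, x = i m.
  split=> [[z [m [n [-> _ _]]]]|[m ->]]; first by exists m.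
  by exists (i (pickle (m, m))), m, m.
have pairing0 : is_pairing R0.
  split=> [x y z [m [n [-> -> ->]]]|x y /field0[m ->] /field0[n ->]|].
  - by split; apply/field0; [exists m|exists n|exists (pickle (m, n))].
  - by exists (i (pickle (m, n))), m, n.
  - move=> x y x' y' z [m [n [-> -> ->]]] [m' [n' [-> -> /iinj]]].
    by move=> /(pcan_inj pickleK) [-> ->].
have [F FP Ftot|R [PR Rmax]] :=
    @Zorn_bigcup _ [set R | is_pairing (R0 `|` R)].
  by apply: bigcup_pairing.
have [cl tot inj] := PR.
pose B := field_of (R0 `|` R).
have Bi n : B (i n) by exists (i (pickle (n, n))); left; exists n, n.
have /choice[f fP] (p : T * T) : exists z, B p.1 -> B p.2 -> (R0 `|` R) (p, z).
  move: p => [x y] /=; have [[Bx By]|nB] := pselect (B x /\ B y).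
    by have [z Rz] := tot x y Bx By; exists z.
  by exists x => Bx By; case: nB.
have fB x y : B x -> B y -> B (f (x, y)).
  by move=> Bx By; have [_ _] := cl _ _ _ (fP (x, y) Bx By).
have finj x y x' y' : B x -> B y -> B x' -> B y' ->
    f (x, y) = f (x', y') -> x = x' /\ y = y'.
  move=> Bx By Bx' By' e; apply: inj (fP (x, y) Bx By) _.
  by rewrite e; exact: fP.
have i01 : i 0 <> i 1 by move=> /iinj.
have [[g gB ginj]|[g gB ginj]] := injection_total B (~` B); last first.
  (* The tags [i 0] and [i 1] separate two copies of [B] inside [B]. *)
  pose c x := if pselect (B x) then f (i 0, x) else f (i 1, g x).
  have cB x : B (c x).
    by rewrite /c; case: pselect => Bx; apply: fB => //; exact: gB.
  have cinj : injective c.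
    move=> x y; rewrite /c; case: pselect => Bx; case: pselect => By.
    - by move=> /finj[].
    - by move=> /finj[]//; exact: gB.
    - by move=> /finj[]//; [exact: gB|move/esym].
    - move=> /finj[]//; [exact: gB|exact: gB|move=> _].
      by apply: ginj; apply/mem_set.
  exists (fun p => f (c p.1, c p.2)) => -[x y] [x' y'] /=.
  by move=> /finj[]// /cinj -> /cinj ->.
have /choice[c cP] x : exists z,
    (B x -> z = f (i 0, x)) /\ (forall q, B q -> x = g q -> z = f (i 1, q)).
  have [Bx|nBx] := pselect (B x).
    by exists (f (i 0, x)); split=> // q /gB Bq xq; rewrite xq in Bx.
  have [[q Bq xq]|nq] := pselect (exists2 q, B q & x = g q).
    exists (f (i 1, q)); split=> // q' Bq' xq'; congr (f (_, _)).
    by apply: ginj; rewrite ?inE// -xq -xq'.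
  by exists x; split=> // q Bq xq; case: nq; exists q.
pose B' := B `|` g @` B.
have cB x : B' x -> B (c x).
  have [cl0 cl1] := cP x.
  by move=> [/[dup] Bx /cl0->|[q Bq /esym/cl1->//]]; exact: fB.
have cinj x y : B' x -> B' y -> c x = c y -> x = y.
  have [[x0 x1] [y0 y1]] := (cP x, cP y).
  move=> [Bx|[q Bq qx]] [By|[q' Bq' qy]].
  - by rewrite x0// y0// => /finj[].
  - by rewrite x0// (y1 q')// => /finj[].
  - by rewrite y0// (x1 q)// => /finj[]// /esym.
  - by rewrite (x1 q)// (y1 q')// -qx -qy => /finj[]// _ ->.
(* New pairs get values in the image of [g], outside [B], so they cannot collide with old values. *)
pose N : set (T * T * T) := [set t | [/\ B' t.1.1, B' t.1.2,
  ~ (B t.1.1 /\ B t.1.2) & t.2 = g (f (c t.1.1, c t.1.2))]].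
have gN x y : B' x -> B' y -> ~ B (g (f (c x, c y))).
  by move=> B'x B'y; apply: gB; apply: fB; exact: cB.
have fieldN x : field_of (R0 `|` R `|` N) x <-> B' x.
  split=> [[z [Rx|[]//]]|[[z Rz]|[q Bq <-]]].
  - by left; exists z.
  - by exists z; left.
  - exists (g (f (c (g q), c (g q)))); right; split=> //=.
    + by right; exists q.
    + by right; exists q.
    + by case=> h _; exact: gB h.
exfalso; apply: (Rmax (R `|` N)).
  split=> [|h]; first by move=> ? ?; left.
  have Bg : ~ B (g (i 0)) by exact: gB.
  have : N (g (i 0), g (i 0), g (f (c (g (i 0)), c (g (i 0))))).
    by split=> //=; [right; exists (i 0)|right; exists (i 0)|case].
  move=> Nt; have Rt := h _ (or_intror Nt).
  by have [] := cl (g (i 0)) (g (i 0)) _ (or_intror Rt).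
rewrite /= setUA; split=> [x y z|x y|x y x' y' z].
- move=> [Rxyz|[/= B'x B'y _ ->]].
    by have [Bx By Bz] := cl _ _ _ Rxyz; split; apply/fieldN; left.
  split; apply/fieldN => //; right; exists (f (c x, c y)) => //.
  by apply: fB; exact: cB.
- move=> /fieldN B'x /fieldN B'y.
  have [[Bx By]|nB] := pselect (B x /\ B y).
    by have [z Rz] := tot x y Bx By; exists z; left.
  by exists (g (f (c x, c y))); right.
- move=> [Rt|[/= Bx By _ zE]] [Rt'|[/= Bx' By' _ zE']].
  + exact: inj Rt Rt'.
  + by have [_ _] := cl _ _ _ Rt; rewrite zE' => /gN; case.
  + by have [_ _] := cl _ _ _ Rt'; rewrite zE => /gN; case.
  + have /ginj : g (f (c x, c y)) = g (f (c x', c y')) by rewrite -zE.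
    rewrite !inE => /(_ (fB _ _ (cB _ Bx) (cB _ By))).
    move=> /(_ (fB _ _ (cB _ Bx') (cB _ By'))) /finj[]; try exact: cB.
    by move=> /cinj -> // /cinj ->.
Qed.

End Squares.

Lemma card_setX_le (T : Type) (K : set T) : infinite_set K -> K `*` K #<= K.
Proof.
move=> /infiniteP /card_leP[i].
have [|f finj] := @square_injection K (fun n => i (to_setT n)).
  by move=> m n /inj; rewrite !inE => /(_ I I) /(congr1 set_val).
have : injective (fun p : K `*` K =>
    f (SigSub (mem_set (set_valP p).1), SigSub (mem_set (set_valP p).2))).
  move=> [[a b] p] [[a' b'] q] /finj /= [e1 e2]; apply: val_inj => /=.
  by rewrite e1 e2.
move=> /injective_card_le.
by rewrite (card_le_eql (card_setT _)) (card_le_eqr (card_setT _)).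
Qed.

(** * Meager subsets of the Cantor space *)

Definition cylinder (x : cantor_space) (n : nat) : set cantor_space :=
  [set y | forall i, (i < n)%N -> y i = x i].

Lemma subset_cylinder x m n : (m <= n)%N -> cylinder x n `<=` cylinder x m.
Proof. by move=> mn y yx i im; apply: yx; exact: leq_trans im mn. Qed.

Lemma nbhs_cylinder (x : cantor_space) n : nbhs x (cylinder x n).
Proof.
elim: n => [|n IHn]; first by apply: filterS filterT => y _ i.
have xn : nbhs x [set y : cantor_space | y n = x n].
  apply: (@proj_continuous nat (fun=> bool) n x [set x n]).
  exact: discrete_set1.
apply: filterS (filterI IHn xn) => y [yn yxn] i.
by rewrite ltnS leq_eqVlt => /orP[/eqP ->|/yn].
Qed.

Lemma nbhs_cylinderP (x : cantor_space) (U : set cantor_space) :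
  nbhs x U <-> exists n, cylinder x n `<=` U.
Proof.
split=> [|[n nU]]; last exact: filterS nU (nbhs_cylinder x n).
pose F : set_system cantor_space := filter_from setT (cylinder x).
have FF : Filter F.
  apply: filter_from_filter; first by exists 0.
  move=> m n _ _; exists (maxn m n) => // y yx.
  by split; apply: subset_cylinder yx; rewrite (leq_maxl, leq_maxr).
have Fx : F --> x.
  apply/cvg_sup => i; apply/cvg_image.
    by apply/seteqP; split=> // b _; exists (fun=> b).
  move=> A /nbhs_singleton Ax; exists [set y : cantor_space | A (y i)].
    by exists i.+1 => // y yx /=; rewrite yx.
  by apply/seteqP; split=> [_ [y Ay <-]//|b Ab]; exists (fun=> b).
by move=> /Fx[n _ nU]; exists n.
Qed.

Lemma nowhere_denseP (A : set cantor_space) : nowhere_dense A <->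
  forall x n, exists y m, [/\ (n <= m)%N, cylinder x n y &
    forall z, cylinder y m z -> ~ A z].
Proof.
split=> [A0 x n|dense]; last first.
  apply/seteqP; split=> // x /nbhs_cylinderP[n nA].
  have [y [m [nm xy yA]]] := dense x n.
  have [z [Az yz]] := nA y xy _ (nbhs_cylinder y m).
  exact: yA yz Az.
have [y xy yA] : exists2 y, cylinder x n y & ~ closure A y.
  apply: contrapT => h; have : interior (closure A) x; last by rewrite A0.
  apply/nbhs_cylinderP; exists n => y xy.
  by apply: contrapT => Ay; apply: h; exists y.
have [B yB AB] : exists2 B, nbhs y B & forall z, A z -> ~ B z.
  apply: contrapT => h; apply: yA => B yB; apply: contrapT => AB.
  by apply: h; exists B => // z Az Bz; apply: AB; exists z.
move/nbhs_cylinderP: yB => [m mB]; exists y, (maxn n m).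
split=> // [|z yz Az]; first exact: leq_maxl.
by apply: (AB z Az); apply: mB; apply: subset_cylinder yz; exact: leq_maxr.
Qed.

Lemma nowhere_denseU (A B : set cantor_space) :
  nowhere_dense A -> nowhere_dense B -> nowhere_dense (A `|` B).
Proof.
move=> /nowhere_denseP Ad /nowhere_denseP Bd; apply/nowhere_denseP => x n.
have [y [m [nm xy yA]]] := Ad x n; have [z [p [mp yz zB]]] := Bd y m.
exists z, p; split=> [||w zw [Aw|Bw]]; last exact: zB zw Bw.
- exact: leq_trans mp.
- by move=> i lt_in; rewrite yz ?xy//; exact: leq_trans nm.
- apply: yA Aw => i im; rewrite -yz//.
  by apply: zw; exact: leq_trans mp.
Qed.

Lemma nowhere_dense_bigcup (F : nat -> set cantor_space) n :
  (forall i, nowhere_dense (F i)) ->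
  nowhere_dense [set x | exists2 i, (i < n)%N & F i x].
Proof.
move=> Fd; elim: n => [|n IHn].
  rewrite (_ : [set _ | _] = set0); last by apply/seteqP; split=> // x [].
  by rewrite /nowhere_dense closure0 interior0.
rewrite (_ : [set _ | _] = [set x | exists2 i, (i < n)%N & F i x] `|` F n).
  exact: nowhere_denseU.
apply/seteqP; split=> x /=.
  move=> [i]; rewrite ltnS leq_eqVlt => /orP[/eqP ->|lt_in] Fx; first by right.
  by left; exists i.
by move=> [[i lt_in Fx]|Fx]; [exists i => //; exact: ltnW|exists n].
Qed.

(* One block on [n, m) works for all the finitely many initial segments of
   length [n]. *)
Lemma nowhere_dense_block (A : set cantor_space) x n : nowhere_dense A ->
  exists y m, [/\ (n < m)%N, cylinder x n y &
    forall z, (forall i, (n <= i < m)%N -> z i = y i) -> ~ A z].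
Proof.
move=> /nowhere_denseP Ad.
pose glue (s : seq bool) (y : cantor_space) : cantor_space :=
  fun i => if (i < n)%N then nth false s i else y i.
have [y [m [nm xy yA]]] : exists y m, [/\ (n < m)%N, cylinder x n y &
    forall s, s \in enum {: n.-tuple bool} ->
    forall z, cylinder (glue s y) m z -> ~ A z].
  (* The segments are treated one by one. Each lengthens the block without changing its earlier
     part, so the segments already treated stay avoided. *)
  elim: (enum _) => [|s l [y [m [nm xy yA]]]].
    by exists x, n.+1; split.
  have [y' [m' [mm' yy' y'A]]] := Ad (glue s y) m.
  pose y'' : cantor_space := fun i => if (i < n)%N then x i else y' i.
  have yy'' i : (i < m)%N -> y'' i = y i.
    move=> im; rewrite /y''; case: ltnP => [/xy //|ni].
    by rewrite yy'// /glue ltnNge ni.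
  exists y'', m'; split; first exact: leq_trans nm mm'.
    by move=> i lt_in; rewrite /y'' lt_in.
  move=> t; rewrite inE => /predU1P[->|/yA{}yA] z zy.
    apply: y'A => i im'; rewrite zy// /glue /y''.
    case: ltnP => // lt_in; rewrite yy'; last exact: ltn_trans nm.
    by rewrite /glue lt_in.
  apply: yA => i im; rewrite zy; last exact: leq_trans mm'.
  by rewrite /glue; case: ifP => // _; rewrite yy''.
exists y, m; split=> // z zy.
apply: (yA (mktuple (fun i : 'I_n => z i))); first by rewrite mem_enum.
move=> i im; rewrite /glue; case: ltnP => [lt_in|ni].
  by rewrite -[i]/(nat_of_ord (Ordinal lt_in)) -tnth_nth tnth_mktuple.
by rewrite zy// ni.
Qed.

Definition differs (x : cantor_space) (h : nat -> nat) : set cantor_space :=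
  [set z | exists m, forall n, (m <= n)%N ->
    exists2 i, (h n <= i < h n.+1)%N & z i <> x i].

Lemma increasing_geq h n : increasing h -> (n <= h n)%N.
Proof.
move=> hinc; elim: n => // n IHn; apply: leq_ltn_trans IHn _.
exact: hinc.
Qed.

Lemma increasing_leq h m n : increasing h -> (m <= n)%N -> (h m <= h n)%N.
Proof. by move=> hinc mn; rewrite (leq_mono hinc). Qed.

(** Stage [n] adds a block on which agreement with [x] forces a point out of the first [n] sets
    [F i]. A point of [F k] thus differs from [x] on every block from the one of index [k.+1] on. *)
Lemma meager_subset_differs (A : set cantor_space) : meager cantor_space A ->
  exists x h, increasing h /\ A `<=` differs x h.
Proof.
move=> [F Fd ->].
pose S n := [set x | exists2 i, (i < n)%N & F i x].
have /choice[step stepP] (p : nat * (cantor_space * nat)) :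
    exists q : cantor_space * nat,
    [/\ (p.2.2 < q.2)%N, cylinder p.2.1 p.2.2 q.1 &
    forall z, (forall i, (p.2.2 <= i < q.2)%N -> z i = q.1 i) -> ~ S p.1 z].
  move: p => [n [x m]].
  have [y [k yk]] := nowhere_dense_block x m (nowhere_dense_bigcup n Fd).
  by exists (y, k).
pose st := fix st n := if n is k.+1 then step (k, st k) else (point, 0).
pose h n := (st n).2.
have hinc : increasing h.
  apply: homo_ltn => [? ? ?|n]; first exact: ltn_trans.
  by have [] := stepP (n, st n).
have agree m n i : (m <= n)%N -> (i < h m)%N -> (st n).1 i = (st m).1 i.
  move=> /subnK <-; elim: (n - m) => // k IHk im.
  have [_ cyl _] := stepP (k + m, st (k + m)).
  rewrite -IHk// addSn; apply: cyl; apply: leq_trans im _.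
  by apply: increasing_leq hinc _; exact: leq_addl.
(* As [i < h i.+1], the value at [i] is settled by stage [i.+1]. *)
pose x : cantor_space := fun i => (st i.+1).1 i.
have xE n i : (i < h n)%N -> x i = (st n).1 i.
  move=> ih; rewrite /x; have [ni|ni] := leqP n i.+1.
    exact: agree.
  by rewrite [RHS](@agree i.+1) ?(ltnW ni)//; exact: increasing_geq.
exists x, h; split=> // z [k _ Fz]; exists k.+1 => n kn.
apply: contrapT => nex.
have [_ _ avoid] := stepP (n, st n).
apply: (avoid z); last by exists k.
move=> i /andP[ni im]; rewrite -[RHS](xE n.+1)//.
apply: contrapT => zx; apply: nex; exists i => //.
by rewrite [(h n <= i)%N]ni.
Qed.

Lemma not_differs x h : ~ differs x h x.
Proof. by move=> [m /(_ m (leqnn m)) [i]]. Qed.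

(** For fixed [m], the points avoiding all [P n] with [m <= n] form a nowhere dense set: every
    cylinder contains one lying inside some [P k] with [m <= k]. *)
Lemma meager_avoid (P : nat -> set cantor_space) :
  (forall x n, exists y m k, [/\ (n <= m)%N, (n <= k)%N, cylinder x n y &
    cylinder y m `<=` P k]) ->
  meager cantor_space [set z | exists m, forall n, (m <= n)%N -> ~ P n z].
Proof.
move=> dense; exists (fun m => [set z | forall n, (m <= n)%N -> ~ P n z]).
  move=> p; apply/nowhere_denseP => x n.
  have [y [m [k [nm nk xy yP]]]] := dense x (maxn n p).
  exists y, m; split.
  - by apply: leq_trans nm; exact: leq_maxl.
  - by apply: subset_cylinder xy; exact: leq_maxl.
  - move=> z yz /(_ k); apply; last exact: yP.
    by apply: leq_trans nk; exact: leq_maxr.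
by apply/seteqP; split=> z [m]; [exists m|move=> _ h; exists m].
Qed.

Lemma meager_differs x h : increasing h -> meager cantor_space (differs x h).
Proof.
move=> hinc.
have -> : differs x h = [set z | exists m, forall n, (m <= n)%N ->
    ~ forall i, (h n <= i < h n.+1)%N -> z i = x i].
  apply/seteqP; split=> z [m mP]; exists m => n /mP.
    by move=> [i ni zx] /(_ i ni).
  move=> nz; apply: contrapT => nex; apply: nz => i ni.
  by apply: contrapT => zx; apply: nex; exists i.
apply: (@meager_avoid (fun n => [set z | forall i, (h n <= i < h n.+1)%N ->
  z i = x i])) => y n.
(* Since [n <= h n], fixing the first [n] values leaves the [n]-th block free to copy [x]. *)
exists (fun i => if (i < n)%N then y i else x i), (h n.+1), n; split=> //.
- exact: leq_trans (leqnSn n) (increasing_geq _ hinc).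
- by move=> i lt_in; rewrite lt_in.
- move=> z zP i /andP[ni im]; rewrite zP//.
  by rewrite ltnNge (leq_trans (increasing_geq n hinc) ni).
Qed.

(** * Comparison of the cardinals *)

Lemma has_cardinality_le (T U : Type) (A : set T) (B : set U) a b :
  has_cardinality A a -> has_cardinality B b -> (a <= b)%O = (A #<= B).
Proof.
have [A' ->] := cardinal_ofP a; have [B' ->] := cardinal_ofP b.
move=> /has_cardinality_of AA /has_cardinality_of BB.
rewrite -[LHS]/(cardinal_le _ _) cardinal_le_of.
by rewrite (card_le_eql AA) (card_le_eqr BB).
Qed.

Lemma cardinal_min_le (S : set cardinal) c : S c -> (cardinal_min S <= c)%O.
Proof. by move=> Sc; have [|_] := @cardinal_minP S; [exists c|exact]. Qed.

Lemma card_le_has_cardinality (T U : Type) (A : set T) (B : set U) b :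
  has_cardinality B b -> A #<= B ->
  exists2 a, has_cardinality A a & (a <= b)%O.
Proof.
move=> Bb AB; have [a Aa] : exists a, has_cardinality A a.
  apply: has_cardinality_ex; case: Bb => B' _ BB.
  by apply: card_le_trans AB _; rewrite -(card_le_eql BB) card_leT.
by exists a => //; rewrite (has_cardinality_le Aa Bb).
Qed.

Lemma infinite_dominating D : is_dominating D -> infinite_set D.
Proof.
move=> Ddom /finite_seqP[s sD].
have [g] := Ddom (fun n => (\sum_(g <- s) g n).+1)%N.
rewrite sD /= => gs [N _ /(_ N (leqnn N))] /=.
by rewrite (big_rem g)//= ltnNge leq_addr.
Qed.

(** * Lower bound by the dominating number *)

Definition meets_blocks (f : nat -> nat) : set cantor_space :=
  [set z | exists m, forall n, (m <= n)%N ->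
    ~ forall i, (n <= i <= f n)%N -> z i = false].

Lemma meager_meets_blocks f : meager cantor_space (meets_blocks f).
Proof.
apply: (@meager_avoid (fun n => [set z | forall i, (n <= i <= f n)%N ->
  z i = false])) => x n.
exists (fun i => (i < n)%N && x i), (maxn n (f n).+1), n; split=> //.
- exact: leq_maxl.
- by move=> i lt_in; rewrite lt_in.
- move=> z zP i /andP[ni ifn]; rewrite zP; first by rewrite ltnNge ni.
  by rewrite leq_max [X in _ || X]ltnS ifn orbT.
Qed.

(** If [f n] exceeds [h n.*2.+1] infinitely often, let [z] copy [y] on the even blocks selected by
    [hit] and be true elsewhere. The odd blocks separate the selected ones, so [z] vanishes on no
    interval [[n, f n]]; yet it agrees with [y] on infinitely many blocks. *)
Lemma meets_blocks_dominated f y h : {homo f : m n / (m <= n)%N} ->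
  (forall n, n <= f n)%N -> increasing h -> meets_blocks f `<=` differs y h ->
  eventually_le f (fun k => h k.*2.+1).
Proof.
move=> fmono fge hinc sub; apply: contrapT => nle.
have bad m : exists2 n, (m <= n)%N & (h n.*2.+1 < f n)%N.
  apply: contrapT => nex; apply: nle; exists m => // n /= mn.
  by rewrite leqNgt; apply/negP => lt; apply: nex; exists n.
(* Testing [f] at the start of the block makes, by monotonicity, every [[i, f i]] starting inside
   the block reach past its end. *)
pose hit i n := (h n.*2 <= i < h n.*2.+1)%N && (h n.*2.+1 <= f (h n.*2))%N.
pose z : cantor_space := fun i => if pselect (exists n, hit i n) then y i
  else true.
have zhit i : z i = false -> exists n, hit i n.
  by rewrite /z; case: pselect.
have [m mP] : differs y h z.
  apply: sub; exists 0 => n _ zn.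
  have [|k /andP[/andP[kn nk] kf]] := zhit n; first by rewrite zn// leqnn fge.
  have hkf : (h k.*2.+1 <= f n)%N by apply: leq_trans kf _; exact: fmono.
  have /zhit[l /andP[/andP[]]] : z (h k.*2.+1) = false.
    by apply: zn; rewrite (ltnW nk).
  rewrite (leq_mono hinc) (leqW_mono (leq_mono hinc)) ltnS => lk kl _.
  have : k.*2.+1 = l.*2 by apply/eqP; rewrite eqn_leq kl lk.
  by move=> /(congr1 odd) /=; rewrite !odd_double.
have [n mn nf] := bad m.
have [|i ni] := mP n.*2; first by rewrite -addnn; exact: leq_trans (leq_addr _ _).
rewrite /z; case: pselect => // -[]; exists n; rewrite /hit ni /=.
apply: leq_trans (ltnW nf) _; apply: fmono.
by apply: leq_trans (increasing_geq _ hinc); rewrite -addnn leq_addr.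
Qed.

Lemma dominating_number_le_cof_meager :
  (dominating_number <= cof (meager cantor_space))%O.
Proof.
have [F [FM Fcof] Fcard] := cofP (meager cantor_space).
have /choice[h hP] (B : set cantor_space) : exists h, meager cantor_space B ->
    increasing h /\ exists y, B `<=` differs y h.
  have [MB|nMB] := pselect (meager cantor_space B); last by exists id.
  have [y [h [hinc sub]]] := meager_subset_differs MB.
  by exists h => _; split=> //; exists y.
have [d Dd dle] := card_le_has_cardinality Fcard
  (card_image_le (fun B k => h B k.*2.+1) F).
apply: le_trans dle; apply: cardinal_min_le; eexists; last exact: Dd.
(* The partial sums are monotone and above [f]; the term [n] puts them above the identity. *)
move=> f; pose g n := (n + \sum_(i < n.+1) f i)%N.
have gmono : {homo g : m n / (m <= n)%N}.
  apply: homo_leq => [//|? ? ?|n]; first exact: leq_trans.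
  by rewrite /g [in leqRHS]big_ord_recr/= leq_add// leq_addr.
have [B FB gB] := Fcof _ (meager_meets_blocks g).
have [hinc [y By]] := hP B (FM _ FB).
exists (fun k => h B k.*2.+1); first by exists B.
have [|N _ gh] := meets_blocks_dominated gmono _ hinc (subset_trans gB By).
  by move=> n; exact: leq_addr.
exists N => // n /gh /=; apply: leq_trans.
by rewrite /g big_ord_recr/= addnA leq_addl.
Qed.

(** * Lower bound by the covering numbers *)

Lemma logn2_unbounded p n : exists2 k, (n <= k)%N & logn 2 k = p.
Proof.
exists (2 ^ p * 3 ^ n)%N.
  apply: leq_trans (ltnW (ltn_expl n (isT : 1 < 3)%N)) _.
  by rewrite leq_pmull// expn_gt0.
by rewrite lognM ?expn_gt0// !lognX lognE /= muln1 [logn 2 3]lognE muln0 addn0.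
Qed.

(* [logn 2] takes every value infinitely often, so that every finite sequence
   is guessed infinitely often. *)
Definition guess (g : nat -> nat) (y : cantor_space) (n : nat) : seq bool :=
  mkseq (fun i => y i (+) nth false (odflt [::] (unpickle (logn 2 n))) i) (g n).

(** The roles are symmetric: [x] extends [guess g y n] exactly when [y] extends [guess g x n]. *)
Lemma meager_not_guessed g x :
  meager cantor_space [set y | exists m, forall n, (m <= n)%N ->
    ~ initial_segment (guess g y n) x].
Proof.
apply: (@meager_avoid (fun n => [set y | initial_segment (guess g y n) x])).
move=> y n; pose s := mkseq (fun i => x i (+) y i) n.
have [k nk kE] := logn2_unbounded (pickle s) n.
(* This point is [y] below [n], and [x] from [n] on, where [nth] returns its default [false]. *)
exists (fun i => x i (+) nth false s i), (maxn n (g k)), k; split=> //.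
- exact: leq_maxl.
- by move=> i lt_in; rewrite nth_mkseq// addKb.
- move=> z zP i; rewrite size_mkseq => ik; rewrite nth_mkseq// kE pickleK /=.
  by rewrite zP ?addbK// leq_max ik orbT.
Qed.

Lemma cov_yorioka_le_cof_meager f : increasing f ->
  (cov (yorioka f) <= cof (meager cantor_space))%O.
Proof.
move=> finc.
have [F [FM Fcof] Fcard] := cofP (meager cantor_space).
have /choice[y yP] (B : set cantor_space) :
    exists y, meager cantor_space B -> ~ B y.
  have [MB|nMB] := pselect (meager cantor_space B); last by exists point.
  have [y [h [_ sub]]] := meager_subset_differs MB.
  by exists y => _ /sub /not_differs.
pose g n := f (n ^ n)%N.
have [c Gc cle] := card_le_has_cardinality Fcard
  (card_image_le (fun B => infinitely_often (guess g (y B))) F).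
apply: le_trans cle; apply: cardinal_min_le; eexists; last exact: Gc.
split=> [_ [B FB <-]|].
  exists g.
    move=> k; exists k.+1 => // n /= kn; apply: increasing_leq finc _.
    by apply: leq_pexp2l; [exact: leq_trans kn|exact: ltnW].
  exists (guess g (y B)) => //.
  by apply/funext => n; rewrite /height size_mkseq.
apply/seteqP; split=> // x _.
(* [B] contains every point whose guesses catch [x] only finitely often, whereas [y B] lies outside
   [B]. *)
have [B FB xB] := Fcof _ (meager_not_guessed g x).
exists (infinitely_often (guess g (y B))); first by exists B.
move=> m; apply: contrapT => nex; apply: (yP B (FM _ FB)); apply: xB.
by exists m => n mn xn; apply: nex; exists n.
Qed.

(** * Upper bound *)

Fixpoint iterate_blocks (e : nat -> nat) (n : nat) : nat :=
  if n is k.+1 then maxn (iterate_blocks e k).+1 (e (iterate_blocks e k))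
  else 0.

Lemma increasing_iterate_blocks e : increasing (iterate_blocks e).
Proof.
apply: homo_ltn => [? ? ?|n]; first exact: ltn_trans.
exact: leq_maxl.
Qed.

(** Almost every new block contains a whole block of [h] on which [x] and [y] agree, and there
    differing from [x] is differing from [y]. With [y = x] this merely coarsens the blocks. *)
Lemma differs_subset x h y e : increasing h ->
  (\forall i \near \oo, exists k, [/\ (i <= h k)%N, (h k.+1 <= e i)%N &
    forall j, (h k <= j < h k.+1)%N -> x j = y j]) ->
  differs x h `<=` differs y (iterate_blocks e).
Proof.
(* Starting at [h m] forces [m <= k], because [h m <= i <= h k]. *)
move=> hinc [N _ NP] z [m zm]; exists (maxn N (h m)) => n.
rewrite geq_max => /andP[Nn mn]; set i := iterate_blocks e n.
have ni : (n <= i)%N by exact: increasing_geq (@increasing_iterate_blocks e).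
have [k [ik kei xy]] := NP i (leq_trans Nn ni).
have [|j /andP[kj jk] zx] := zm k.
  by rewrite -(leq_mono hinc) (leq_trans mn)// (leq_trans ni).
exists j; last by rewrite -xy ?kj.
rewrite (leq_trans ik kj)/=; apply: leq_trans jk _.
by apply: leq_trans kei _; exact: leq_maxr.
Qed.

(** The shift in [h n.+1] makes [sigma n], for large [n], long enough to cover the whole [n]-th
    block; [much_less] is applied with exponent 1. *)
Lemma yorioka_match h A : increasing h -> yorioka (fun n => h n.+1) A ->
  exists y : cantor_space, forall x, A x -> forall m, exists2 n, (m <= n)%N &
    forall i, (h n <= i < h n.+1)%N -> x i = y i.
Proof.
move=> hinc [g /(_ 1)[N _ hg] [sigma Asigma sg]].
(* The blocks are disjoint, so at most one [n] prescribes the value at [i]; positions below [h 0]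
   get [false]. *)
have /choice[y yP] i : exists b, forall n, (h n <= i < h n.+1)%N ->
    b = nth false (sigma n) i.
  have [[n /andP[ni im]]|nex] := pselect (exists n, h n <= i < h n.+1)%N.
    exists (nth false (sigma n) i) => n' /andP[ni' im'].
    have lt := leqW_mono (leq_mono hinc).
    suff -> : n = n' by [].
    apply/eqP; rewrite eqn_leq -ltnS -lt (leq_ltn_trans ni im') /=.
    by rewrite -ltnS -lt (leq_ltn_trans ni' im).
  by exists false => n ni; case: nex; exists n.
exists y => x /Asigma xs m; have [n mn nx] := xs (maxn N m).
exists n; first by apply: leq_trans mn; exact: leq_maxr.
move=> i /[dup] /andP[_ im] /yP ->; rewrite nx//.
apply: leq_trans im _; rewrite -[size _]/(height sigma n) sg -[n in h n.+1]expn1.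
by apply: hg; apply: leq_trans mn; exact: leq_maxl.
Qed.

Lemma cof_meager_le :
  (cof (meager cantor_space) <= Order.max dominating_number supcov)%O.
Proof.
set c := Order.max _ _; have [K KE] := cardinal_ofP c.
have Kc : has_cardinality K c by rewrite KE; apply/has_cardinality_of.
have [D Ddom Dd] := dominating_numberP.
have DK : D #<= K by rewrite -(has_cardinality_le Dd Kc) le_max lexx.
have Kinf : infinite_set K.
  by move=> /(card_le_finite DK); exact: infinite_dominating.
have /pcard_surjP[phi phiP] := DK.
have /choice[Y YP] (h : nat -> nat) :
    exists Y : set cantor_space -> cantor_space, increasing h -> forall x,
    exists2 k, K k & forall m, exists2 n, (m <= n)%N &
      forall i, (h n <= i < h n.+1)%N -> x i = Y k i.
  have [hinc|ninc] := pselect (increasing h); last by exists (fun=> point).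
  have finc : increasing (fun n => h n.+1) by move=> m n mn; exact: hinc.
  have [F [FI Fcov] Fc] := covP finc.
  have /pcard_surjP[psi psiP] : F #<= K.
    rewrite -(has_cardinality_le Fc Kc) le_max; apply/orP; right.
    by have [ub _] := cardinal_supP [set cov (yorioka f) | f in increasing];
      apply: ub; exists (fun n => h n.+1).
  have /choice[Z ZP] A : exists y : cantor_space, F A -> forall x, A x ->
      forall m, exists2 n, (m <= n)%N &
      forall i, (h n <= i < h n.+1)%N -> x i = y i.
    have [FA|nFA] := pselect (F A); last by exists point.
    by have [y yP] := yorioka_match hinc (FI _ FA); exists y.
  exists (Z \o psi) => _ x.
  have [A FA Ax] : (\bigcup_(A in F) A) x by rewrite Fcov.
  by have [k Kk kA] := psiP A FA; exists k => //=; rewrite kA; exact: ZP.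
(* The coordinates of [t] select, in order, the blocks, a member of the covering attached to them,
   and the function that merges them. *)
pose B (t : set cantor_space * set cantor_space * set cantor_space) :=
  differs (Y (iterate_blocks (phi t.1.1)) t.1.2) (iterate_blocks (phi t.2)).
have BK : B @` (K `*` K `*` K) #<= K.
  apply: card_le_trans (card_image_le _ _) _.
  apply: card_le_trans (card_setX_le Kinf).
  have /pcard_surjP[g gP] := card_setX_le Kinf.
  apply/pcard_surjP; exists (fun t => (g t.1, t.2)) => -[u k] [/gP[l Kl lu] Kk].
  by exists (l, k) => //=; rewrite lu.
have [b Bb] := card_le_has_cardinality Kc BK; apply: le_trans.
apply: cardinal_min_le; exists (B @` (K `*` K `*` K)) => //; split.
  by move=> _ [t _ <-]; exact/meager_differs/increasing_iterate_blocks.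
move=> A /meager_subset_differs[x [h [hinc Ax]]].
have [e De eh] := Ddom (fun i => h i.+1); have [p Kp pe] := phiP e De.
set j := iterate_blocks e; have jinc := @increasing_iterate_blocks e.
(* As [i <= h i] and [h i.+1 <= e i] for almost all [i], the [i]-th block of [h] lies in
   [[i, e i)]. *)
have xj : differs x h `<=` differs x j.
  apply: differs_subset => //; case: eh => N _ eh; exists N => // i /eh hei.
  by exists i; split=> //; exact: increasing_geq.
have [q Kq xY] := YP j jinc x.
(* [e' i] bounds the end of some block of agreement that starts at or after [i]; any larger value
   serves as well. *)
have /choice[e' e'P] i : exists v, exists k, [/\ (i <= j k)%N, (j k.+1 <= v)%N &
    forall l, (j k <= l < j k.+1)%N -> x l = Y j q l].
  have [n ni nP] := xY i; exists (j n.+1), n; split=> //.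
  by apply: leq_trans ni _; exact: increasing_geq.
have [d Dd' e'd] := Ddom e'; have [r Kr rd] := phiP d Dd'.
exists (B (p, q, r)); first by exists (p, q, r).
apply: subset_trans Ax _; apply: subset_trans xj _.
rewrite /B /= pe rd; apply: differs_subset => //.
case: e'd => N _ e'd; exists N => // i /e'd /= e'di.
have [k [ik kv kP]] := e'P i; exists k; split=> //; exact: leq_trans e'di.
Qed.

Theorem theorem3p20 :
  cof (meager cantor_space) = Order.max dominating_number supcov.
Proof.
apply/eqP; rewrite eq_le cof_meager_le ge_max dominating_number_le_cof_meager /=.
have [_ lub] := cardinal_supP [set cov (yorioka f) | f in increasing].
by apply: lub => _ [f finc <-]; exact: cov_yorioka_le_cof_meager.
Qed.
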